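(* Let $N\ge 1$ and let $(G,\epsilon)$ be a commutation symmetry, i.e. $G\subseteq\mathcal{S}_N$ is a subgroup and $\epsilon:G\to\mathcal{S}^1$ is a homomorphism of $G$ onto a finite subgroup of $\mathcal{S}^1=\{z\in\mathbb{C}: |z|=1\}$. Then $\epsilon:G\to\mathbb{C}$ is a $1$-dimensional character of $G$, which is irreducible. Consequently, the idempotent $$e_\epsilon:=\frac{1}{|G|}\sum_{p\in G}\epsilon(p)\,p\in\mathbb{C}[\mathcal{S}_N]$$ satisfies $\overline{e_\epsilon}^{\ast}=e_\epsilon$.
   Context: $\mathcal{S}_N$ is the symmetric group of permutations of $\{1,\dots,N\}$ with product $(p\circ q)(i)=p(q(i))$, and $\mathbb{C}[\mathcal{S}_N]$ is its complex group ring. For $a=\sum_p a_p\,p\in\mathbb{C}[\mathcal{S}_N]$ put $\overline{a}:=\sum_p\overline{a_p}\,p$ (complex conjugation of coefficients) and $a^{\ast}:=\sum_p a_p\,p^{-1}$; thus $\overline{a}^{\ast}=\sum_p\overline{a_p}\,p^{-1}$. *)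

(* Defs.v *)
From HB Require Import structures.
From mathcomp Require Import all_boot all_order all_algebra all_fingroup.
From mathcomp Require Import mxrepresentation.
From mathcomp Require Import complex reals.
Set Implicit Arguments.
Unset Strict Implicit.
Unset Printing Implicit Defensive.
Import Order.TTheory GRing.Theory Num.Theory.
Local Open Scope ring_scope.
Local Open Scope complex_scope.

(* MathComp's product of permutations is (p * q)%g i = q (p i); products are
   taken here in the order (p o q)(i) = p (q i). *)
Definition perm_comp (N : nat) (p q : 'S_N) : 'S_N := (q * p)%g.

Lemma perm_compE (N : nat) (p q : 'S_N) (i : 'I_N) : perm_comp p q i = p (q i).
Proof. by rewrite /perm_comp permM. Qed.

(* The group ring K[S_N]: a p is the coefficient of p. A new name is used since
   {ffun _ -> K} already carries the pointwise product. *)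
Definition sym_ring (K : comNzRingType) (N : nat) := {ffun 'S_N -> K^o}.

Definition sym_ring_fun (K : comNzRingType) (N : nat) (a : sym_ring K N) :
  'S_N -> K := fun p => fun_of_fin a p.
Coercion sym_ring_fun : sym_ring >-> Funclass.

HB.instance Definition _ (K : comNzRingType) (N : nat) :=
  GRing.Lmodule.copy (sym_ring K N) {ffun 'S_N -> K^o}.

Section SymRing.
Variables (K : comNzRingType) (N : nat).
Implicit Types (a b c : sym_ring K N) (p q r : 'S_N).

Definition sym_elt p : sym_ring K N := [ffun q => (q == p)%:R].

Definition sym_mul a b : sym_ring K N :=
  \sum_p \sum_q (a p * b q) *: sym_elt (perm_comp p q).

Let srE a b : (forall p, a p = b p) -> a = b.
Proof. by move=> eq_ab; apply/ffunP. Qed.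

Lemma sym_mulE a b r : sym_mul a b r = \sum_p a p * b (r * p^-1)%g.
Proof.
rewrite /sym_ring_fun /sym_mul sum_ffunE; apply: eq_bigr => p _.
rewrite sum_ffunE (bigD1 (r * p^-1)%g) //= big1 => [|q neq_q].
  by rewrite !ffunE /perm_comp mulgKV eqxx addr0 /GRing.scale /= mulr1.
rewrite !ffunE /perm_comp; case: eqP => [def_r|_]; last by rewrite scaler0.
by case/eqP: neq_q; rewrite def_r mulgK.
Qed.

Fact sym_mulA : associative sym_mul.
Proof.
move=> a b c; apply: srE => r; rewrite !sym_mulE.
under eq_bigr => p _ do rewrite sym_mulE mulr_sumr.
under [RHS]eq_bigr => p _ do rewrite sym_mulE mulr_suml.
rewrite [RHS]exchange_big /=; apply: eq_bigr => p _.
rewrite [RHS](reindex_inj (mulIg p)) /=; apply: eq_bigr => q _.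
by rewrite mulgK invMg !mulgA mulrA.
Qed.

Fact sym_mul1 : left_id (sym_elt 1%g) sym_mul.
Proof.
move=> a; apply: srE => r; rewrite sym_mulE (bigD1 1%g) //= big1 => [|p np].
  by rewrite /sym_ring_fun ffunE eqxx mul1r addr0 invg1 mulg1.
by rewrite /sym_ring_fun ffunE (negPf np) mul0r.
Qed.

Fact sym_1mul : right_id (sym_elt 1%g) sym_mul.
Proof.
move=> a; apply: srE => r; rewrite sym_mulE (bigD1 r) //= big1 => [|p np].
  by rewrite /sym_ring_fun ffunE mulgV eqxx mulr1 addr0.
rewrite /sym_ring_fun ffunE -eq_mulgV1.
by rewrite eq_sym (negPf np) mulr0.
Qed.

Fact sym_mulDl : left_distributive sym_mul +%R.
Proof.
move=> a b c; apply: srE => r; rewrite {2}/sym_ring_fun ffunE.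
rewrite -!/(sym_ring_fun _ _) !sym_mulE -big_split; apply: eq_bigr => p _.
by rewrite /sym_ring_fun ffunE mulrDl.
Qed.

Fact sym_mulDr : right_distributive sym_mul +%R.
Proof.
move=> a b c; apply: srE => r; rewrite {2}/sym_ring_fun ffunE.
rewrite -!/(sym_ring_fun _ _) !sym_mulE -big_split; apply: eq_bigr => p _.
by rewrite /sym_ring_fun ffunE mulrDr.
Qed.

Fact sym_1neq0 : sym_elt 1%g != 0.
Proof.
apply/eqP=> /ffunP/(_ 1%g); rewrite !ffunE eqxx => /eqP.
by rewrite oner_eq0.
Qed.

HB.instance Definition _ := GRing.Zmodule_isNzRing.Build (sym_ring K N)
  sym_mulA sym_mul1 sym_1mul sym_mulDl sym_mulDr sym_1neq0.

Fact sym_scalerAl (k : K) a b : k *: (a * b) = (k *: a) * b.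
Proof.
apply: srE => r; rewrite {1}/sym_ring_fun ffunE.
rewrite -!/(sym_ring_fun _ _) !sym_mulE /GRing.scale /= mulr_sumr.
by apply: eq_bigr => p _; rewrite {3}/sym_ring_fun ffunE mulrA.
Qed.

Fact sym_scalerAr (k : K) a b : k *: (a * b) = a * (k *: b).
Proof.
apply: srE => r; rewrite {1}/sym_ring_fun ffunE.
rewrite -!/(sym_ring_fun _ _) !sym_mulE /GRing.scale /= mulr_sumr.
by apply: eq_bigr => p _; rewrite {4}/sym_ring_fun ffunE mulrCA.
Qed.

HB.instance Definition _ :=
  GRing.Lmodule_isLalgebra.Build K (sym_ring K N) sym_scalerAl.
HB.instance Definition _ :=
  GRing.Lalgebra_isAlgebra.Build K (sym_ring K N) sym_scalerAr.

Definition sym_star a : sym_ring K N := \sum_p a p *: sym_elt p^-1%g.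

End SymRing.

Arguments sym_elt K {N} p.

Section Complex.
Variables (R : realType) (N : nat).
Implicit Types (G : {group 'S_N}) (eps chi : 'S_N -> R[i]).

Definition sym_conj (a : sym_ring R[i] N) : sym_ring R[i] N :=
  \sum_p (a p)^*%C *: sym_elt R[i] p.

(* A finite subgroup of the unit circle, given by a list of its elements. *)
Definition finite_circle_subgroup (U : seq R[i]) : Prop :=
  [/\ {in U, forall z, `|z| = 1},
      1 \in U,
      {in U &, forall z w, z * w \in U} &
      {in U, forall z, z^-1 \in U}].

(* eps is total for convenience: only its values on G matter. *)
Definition commutation_symmetry G eps : Prop :=
  {in G &, forall p q, eps (perm_comp p q) = eps p * eps q} /\
  exists2 U : seq R[i], finite_circle_subgroup U &
    forall z, z \in U <-> exists2 p, p \in G & eps p = z.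

(* MathComp's representations act on row vectors, so that rG (q * p)%g =
   rG q *m rG p applies first q, then p: this is a representation for the
   product perm_comp. *)
Definition affords G (n : nat) (rG : mx_representation R[i] G n) chi : Prop :=
  {in G, forall p, chi p = \tr (rG p)}.

Definition character_of_dim G (n : nat) chi : Prop :=
  exists rG : mx_representation R[i] G n, affords rG chi.

Definition irreducible_character G chi : Prop :=
  exists (n : nat) (rG : mx_representation R[i] G n),
    mx_irreducible rG /\ affords rG chi.

Definition e_eps G eps : sym_ring R[i] N :=
  (#|G|%:R)^-1 *: \sum_(p in G) eps p *: sym_elt R[i] p.

End Complex.

(* Main.v *)
Require Import Defs.
From mathcomp Require Import all_boot all_order all_algebra all_fingroup.
From mathcomp Require Import mxrepresentation.
From mathcomp Require Import complex reals.
Import Order.TTheory GRing.Theory Num.Theory.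
Local Open Scope ring_scope.
Local Open Scope complex_scope.

(** The image of [eps] consists of numbers of modulus 1, so that [eps] never
vanishes on [G] and is a homomorphism into the units of the field; since the
field is commutative, the order in which permutations are composed is
irrelevant.  Hence [p |-> (eps p)%:M] is a representation of degree 1; its
trace is [eps], and it is irreducible because a line has no proper nonzero
subspace.

The two identities about [e_eps] are checked coefficientwise
([sym_coef_e_eps]).  For [r] in [G], the coefficient of [r] in the square is
an average over [p] in [G] of [eps p * eps (r * p^-1)], and every such term
equals [eps r].  Conjugating and inverting replaces [eps r] by the conjugate
of [eps r^-1], that is of the inverse of [eps r]; on the unit circle,
conjugation is inversion ([conjc_unit_circle]), so [eps r] comes back. *)

Lemma sym_ringP (K : comNzRingType) (N : nat) (a b : sym_ring K N) :
  (forall p, a p = b p) -> a = b.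
Proof. by move=> eq_ab; apply/ffunP. Qed.

Lemma sym_coefZ (K : comNzRingType) (N : nat) (k : K) (a : sym_ring K N) r :
  (k *: a) r = k * a r.
Proof. by rewrite /sym_ring_fun ffunE. Qed.

Lemma sym_coef_sum (K : comNzRingType) (N : nat) (P : pred 'S_N)
    (c : 'S_N -> K) r :
  ((\sum_(p | P p) c p *: sym_elt K p) : sym_ring K N) r
    = if P r then c r else 0.
Proof.
have coefZ p : (c p *: sym_elt K p) r = c p * (r == p)%:R.
  by rewrite sym_coefZ /sym_ring_fun ffunE.
rewrite /sym_ring_fun sum_ffunE; case: ifP => [Pr | nPr].
  rewrite (bigD1 r) //= big1 => [|p /andP[_ neq_pr]].
    by rewrite addr0; apply: etrans (coefZ r) _; rewrite eqxx mulr1.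
  by apply: etrans (coefZ p) _; rewrite eq_sym (negPf neq_pr) mulr0.
rewrite big1 // => p Pp; apply: etrans (coefZ p) _.
by case: eqP => [def_r | _]; [rewrite def_r Pp in nPr | rewrite mulr0].
Qed.

Lemma sym_coef_conj (R : realType) (N : nat) (a : sym_ring R[i] N) r :
  sym_conj a r = (a r)^*%C.
Proof. exact: (sym_coef_sum _ _ predT). Qed.

Lemma sym_coef_star (K : comNzRingType) (N : nat) (a : sym_ring K N) r :
  sym_star a r = a r^-1%g.
Proof.
rewrite /sym_star (reindex_inj invg_inj) /=.
under eq_bigr => p _ do rewrite invgK.
exact: (sym_coef_sum _ _ predT (fun p => a p^-1%g)).
Qed.

Lemma sym_coefM (K : comNzRingType) (N : nat) (a b : sym_ring K N) r :
  (a * b) r = \sum_p a p * b (r * p^-1)%g.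
Proof. exact: sym_mulE. Qed.

Lemma sym_coef_e_eps (R : realType) (N : nat) (G : {group 'S_N})
    (eps : 'S_N -> R[i]) r :
  e_eps G eps r = #|G|%:R^-1 * (if r \in G then eps r else 0).
Proof.
rewrite /e_eps; apply: etrans (sym_coefZ _ _ _ _ _) _.
by rewrite sym_coef_sum.
Qed.

Lemma conjc_unit_circle (R : realType) (z : R[i]) : `|z| = 1 -> z^*%C = z^-1.
Proof. by move=> z1; rewrite invc_norm z1 expr1n invr1 mul1r. Qed.

Section CommutationSymmetry.
Variables (R : realType) (N : nat) (G : {group 'S_N}) (eps : 'S_N -> R[i]).
Hypothesis hG : commutation_symmetry G eps.

Lemma norm_eps p : p \in G -> `|eps p| = 1.
Proof.
case: hG => _ [U [normU _ _ _] imU] Gp.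
by apply: normU; apply/imU; exists p.
Qed.

Lemma eps_neq0 p : p \in G -> eps p != 0.
Proof. by move=> Gp; rewrite -normr_eq0 norm_eps ?oner_eq0. Qed.

Lemma epsM : {in G &, {morph eps : p q / (p * q)%g >-> p * q}}.
Proof. by case: hG => epsM _ p q Gp Gq; rewrite mulrC -epsM. Qed.

(** The value of [eps] at the identity is a nonzero idempotent of a field. *)
Lemma eps1 : eps 1%g = 1.
Proof.
have G1 := group1 G; apply: (mulfI (eps_neq0 _ G1)).
by rewrite -epsM // mulg1 mulr1.
Qed.

Lemma epsV p : p \in G -> eps p^-1%g = (eps p)^-1.
Proof.
move=> Gp; apply: (mulfI (eps_neq0 _ Gp)).
by rewrite -epsM ?groupV // mulgV eps1 divff ?eps_neq0.
Qed.

Lemma eps_mx_repr : mx_repr G (fun p => (eps p)%:M : 'M[R[i]]_1).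
Proof.
split=> [|p q Gp Gq]; first by rewrite eps1.
by rewrite epsM // scalar_mxM.
Qed.

Lemma eps_affords : affords (MxRepresentation eps_mx_repr) eps.
Proof. by move=> p _; rewrite /= mxtrace_scalar. Qed.

Lemma e_eps_idempotent : e_eps G eps * e_eps G eps = e_eps G eps.
Proof.
apply: sym_ringP => r; apply: etrans (sym_coefM _ _ _ _ _) _.
rewrite (bigID (mem G)) /=.
rewrite [X in _ + X]big1 ?addr0; last first.
  by move=> p /negPf nGp; rewrite sym_coef_e_eps nGp mulr0 mul0r.
(* For p in G, the product r * p^-1 lies in G exactly when r does, so that each
   term is |G|^-1 times the coefficient of r. *)
transitivity (\sum_(p in G) #|G|%:R^-1 * e_eps G eps r).
  apply: eq_bigr => p Gp; rewrite !sym_coef_e_eps Gp groupMr ?groupV //.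
  case: ifP => [Gr|_]; last by rewrite !mulr0.
  rewrite epsM ?groupV // epsV // -mulrA; congr (_ * _).
  by rewrite mulrCA; congr (_ * _); rewrite mulrCA divff ?mulr1 ?eps_neq0.
rewrite sumr_const -mulrnAl -(mulr_natl _^-1) divff ?mul1r //.
by rewrite pnatr_eq0 -lt0n cardG_gt0.
Qed.

Lemma e_eps_selfadjoint : sym_star (sym_conj (e_eps G eps)) = e_eps G eps.
Proof.
apply: sym_ringP => r; rewrite sym_coef_star sym_coef_conj !sym_coef_e_eps.
rewrite groupV rmorphM /= conjc_inv conjc_nat; congr (_ * _).
case: ifP => [Gr|_]; last exact: conjc0.
by rewrite conjc_unit_circle ?norm_eps ?groupV // epsV // invrK.
Qed.

End CommutationSymmetry.

Theorem corollary2p7 (R : realType) (N : nat) (hN : (1 <= N)%N)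
    (G : {group 'S_N}) (eps : 'S_N -> R[i])
    (hG : commutation_symmetry G eps) :
  [/\ character_of_dim G 1 eps,
      irreducible_character G eps,
      e_eps G eps * e_eps G eps = e_eps G eps &
      sym_star (sym_conj (e_eps G eps)) = e_eps G eps].
Proof.
split.
- by exists (MxRepresentation (eps_mx_repr _ _ _ _ hG)); apply: eps_affords.
- exists 1%N, (MxRepresentation (eps_mx_repr _ _ _ _ hG)).
  split; last exact: eps_affords.
  by apply/mx_abs_irrW/linear_mx_abs_irr.
- exact: e_eps_idempotent.
- exact: e_eps_selfadjoint.
Qed.
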